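(* Let $f$ be a field, $L$ a Lie $f$-algebra, $T$ a representation of $L$ in an $f$-space $V$ with basis $(e_i)_{i\in I}$, $I$ linearly ordered, and let $D$ be the diagram of $T$ corresponding to this basis. Let $\Lambda_nV$ be the subspace of $V^{\otimes n}$ with the basis $(e_{i_1}\wedge\dots\wedge e_{i_n})_{(i_1<\dots<i_n)\in\Lambda^nI}$, where $$e_{i_1}\wedge\dots\wedge e_{i_n}=\sum_{s\in S_n}(-1)^{\mathrm{inv}(s)}e_{s(i_1)}\otimes\dots\otimes e_{s(i_n)},\qquad s(i_k):=i_{s(k)},$$ and $\mathrm{inv}(s)$ is the number of inversions in $s\in S_n$. Then $\Lambda^nD$ is the diagram of the subrepresentation $\Lambda_nT$ of $L$ in $\Lambda_nV\subseteq V^{\otimes n}$, corresponding to this basis.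
   Context: $L^\ast=\mathrm{Hom}_f(L,f)$. The diagram of a representation $T$ of $L$ corresponding to a basis $(e_i)_{i\in I}$ is the directed graph (loops allowed, no multiple edges) with vertex set $I$ having an edge $(i,j)$ iff the linear form $w(i,j)\in L^\ast$, $w(i,j)(l)=$ the coefficient of $e_j$ in $T(l)e_i$, is non-zero; the edge is then labeled by (has weight) $w(i,j)$. When there is no edge $(i,j)$, $w(i,j)=0$. A reduced weighted directed graph is one without multiple edges and with non-zero weights. For a reduced weighted directed graph $G$ with linearly ordered vertex set $V(G)$, $\Lambda^nG$ is the reduced weighted directed graph with vertex set $\Lambda^nV(G)=\{(v_1,\dots,v_n)\in V(G)^n: v_1<\dots<v_n\}$ and the following edges. For $A\in V(\Lambda^nG)$ let $v_i(A)$ be its $i$-th entry and $\mathrm{Pr}_i(A)\in V(\Lambda^{n-1}G)$ the sequence obtained by erasing the $i$-th entry. For $A\ne B$, the edge $(A,B)$ exists iff for some $i,j$ one has $\mathrm{Pr}_i(A)=\mathrm{Pr}_j(B)$ and there is an edge $(v_i(A),v_j(B))$ in $G$; its weight is then $(-1)^{j-i}w(v_i(A),v_j(B))$. The loop $(A,A)$ exists iff $\sum_{i\in A}w(i,i)\ne 0$ (sum over the entries of $A$), and this sum is then its weight. *)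

(* Defs.v *)
(* MathComp, with the classical layer of MathComp-Analysis: the vector spaces
   are not assumed to be finite-dimensional. *)
From HB Require Import structures.
From mathcomp Require Import all_boot all_order all_algebra all_fingroup.
From mathcomp Require Import all_classical.

Set Implicit Arguments.
Unset Strict Implicit.
Unset Printing Implicit Defensive.

Import Order.TTheory GRing.Theory.
Local Open Scope ring_scope.

HB.mixin Record Lmodule_isLie (F : pzRingType) L of GRing.Lmodule F L := {
  lie : L -> L -> L;
  lie_linearl : forall y : L, linear (fun x : L => lie x y);
  lie_linearr : forall x : L, linear (lie x);
  liexx : forall x : L, lie x x = 0;
  lie_jacobi : forall x y z : L,
    lie x (lie y z) + lie y (lie z x) + lie z (lie x y) = 0
}.

#[short(type="lieAlgType")]
HB.structure Definition LieAlgebra (F : pzRingType) :=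
  {L of GRing.Lmodule F L & Lmodule_isLie F L}.

Definition dual_space (F : comPzRingType) (L : lmodType F) : Type := {scalar L}.

Section Dual.
Context (F : comPzRingType) (L : lmodType F).
Implicit Types u v w : {scalar L}.

Lemma scalar_funP u v : u =1 v -> u = v.
Proof.
case: u v => [u cu] [v cv] /= /funext uv; subst v.
congr GRing.Linear.Pack.
case: cu cv => [[a] [b]] [[c] [d]].
by rewrite (Prop_irrelevance a c) (Prop_irrelevance b d).
Qed.

Let zero : {scalar L} := GRing.null_fun F.
Let add u v : {scalar L} := GRing.add_fun u v.
Let opp u : {scalar L} := GRing.opp_fun u.

Let addA : associative add.
Proof. by move=> u v w; apply: scalar_funP => x /=; rewrite addrA. Qed.
Let addC : commutative add.
Proof. by move=> u v; apply: scalar_funP => x /=; rewrite addrC. Qed.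
Let add0 : left_id zero add.
Proof. by move=> u; apply: scalar_funP => x /=; rewrite add0r. Qed.
Let addN : left_inverse zero opp add.
Proof. by move=> u; apply: scalar_funP => x /=; rewrite addNr. Qed.

HB.instance Definition _ := gen_eqMixin (dual_space L).
HB.instance Definition _ := gen_choiceMixin (dual_space L).
HB.instance Definition _ :=
  GRing.isZmodule.Build (dual_space L) addA addC add0 addN.

Definition dual_fun (w : dual_space L) : L -> F := fun x => (w : {scalar L}) x.

Lemma dualP (u v : dual_space L) : dual_fun u =1 dual_fun v -> u = v.
Proof. exact: scalar_funP. Qed.

Lemma dual0E x : dual_fun 0 x = 0. Proof. by []. Qed.
Lemma dualDE (u v : dual_space L) x : dual_fun (u + v) x = dual_fun u x + dual_fun v x.
Proof. by []. Qed.
Lemma dualNE (u : dual_space L) x : dual_fun (- u) x = - dual_fun u x.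
Proof. by []. Qed.
End Dual.

Record representation (F : fieldType) (L : lieAlgType F) (V : lmodType F) :=
  Representation {
    rep_fun :> L -> V -> V;
    rep_linearl : forall v, linear (fun l => rep_fun l v);
    rep_linearr : forall l, linear (rep_fun l);
    rep_lie : forall x y v,
      rep_fun (lie x y) v = rep_fun x (rep_fun y v) - rep_fun y (rep_fun x v)
  }.

Section Bases.
Context (F : fieldType) (V : lmodType F) (I : choiceType).

(* v is the finite linear combination of the family e with coefficients c *)
Definition expansion (e : I -> V) (v : V) (c : I -> F) : Prop :=
  finite_set [set i | c i != 0]%classic /\
  v = \sum_(i \in [set: I]%classic) c i *: e i.

(* Hamel basis *)
Definition is_basis (e : I -> V) : Prop :=
  forall v, exists! c : I -> F, expansion e v c.

Definition basis_coord (e : I -> V) (he : is_basis e) (v : V) : I -> F :=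
  projT1 (cid (he v)).

Definition lin_span (e : I -> V) : {pred V} :=
  fun v => `[< exists c, expansion e v c >].

Lemma coord_expansion e (he : is_basis e) v : expansion e v (basis_coord he v).
Proof. by rewrite /basis_coord; case: cid => c [/= ? _]. Qed.

Lemma coord_unique e (he : is_basis e) v c : expansion e v c -> basis_coord he v = c.
Proof. by rewrite /basis_coord; case: cid => d [/= _ ud] /ud. Qed.

Lemma expansion_linear e a u v c d : expansion e u c -> expansion e v d ->
  expansion e (a *: u + v) (fun i => a * c i + d i).
Proof.
move=> [cf ->] [df ->]; split.
  apply: (@sub_finite_set _ _ ([set i | c i != 0] `|` [set i | d i != 0])%classic).
    move=> i /=; apply: contra_neqP => /not_orP[].
    by move=> /negP/negPn/eqP-> /negP/negPn/eqP->; rewrite mulr0 addr0.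
  by rewrite finite_setU.
pose X := ([set i | c i != 0] `|` [set i | d i != 0])%classic.
have Xf : finite_set X by rewrite finite_setU.
have E (g : I -> F) : (forall i, g i != 0 -> X i) ->
    \sum_(i \in [set: I]%classic) g i *: e i = \sum_(i \in X) g i *: e i.
  move=> gX; apply/esym/fsbig_widen => // i [_ nXi] /=.
  by have [->|/gX//] := eqVneq (g i) 0; rewrite scale0r.
have Ec : forall i, c i != 0 -> X i by move=> i ci; left.
have Ed : forall i, d i != 0 -> X i by move=> i di; right.
have Ecd : forall i, a * c i + d i != 0 -> X i.
  move=> i; apply: contra_neqP => /not_orP[].
  by move=> /negP/negPn/eqP-> /negP/negPn/eqP->; rewrite mulr0 addr0.
rewrite (E _ Ec) (E _ Ed) (E _ Ecd).
rewrite !fsbig_finite//= scaler_sumr -big_split/=.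
by apply: eq_bigr => i _; rewrite scalerDl scalerA.
Qed.

Lemma coord_linear e (he : is_basis e) a u v i :
  basis_coord he (a *: u + v) i = a * basis_coord he u i + basis_coord he v i.
Proof.
have := expansion_linear a (coord_expansion he u) (coord_expansion he v).
by move=> /coord_unique ->.
Qed.

Lemma expansion_delta e i : expansion e (e i) (fun j => (j == i)%:R).
Proof.
split.
  apply: (@sub_finite_set _ _ [set i]%classic) => //= j /=.
  by case: (eqVneq j i) => //; rewrite eqxx.
rewrite -(@fsbig_widen _ _ _ _ [set i]%classic)//=.
  by rewrite fsbig_set1 eqxx scale1r.
by move=> j [_ /= /eqP/negbTE ->]; rewrite scale0r.
Qed.

Lemma span_submod e : submod_closed (lin_span e).
Proof.
split.
  apply/asboolP; exists (fun=> 0); split.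
    by apply: (@sub_finite_set _ _ set0) => // i /=; rewrite eqxx.
  by rewrite fsbig1// => i _; rewrite scale0r.
move=> a u v /asboolP[c cu] /asboolP[d dv]; apply/asboolP.
by eexists; exact: expansion_linear cu dv.
Qed.

HB.instance Definition _ (e : I -> V) :=
  GRing.isSubmodClosed.Build F V (lin_span e) (span_submod e).

Lemma mem_lin_span e i : e i \in lin_span e.
Proof. by apply/asboolP; eexists; exact: expansion_delta. Qed.

Definition span_of (e : I -> V) : Type := {v : V | v \in lin_span e}.

HB.instance Definition _ e := Choice.on (span_of e).
HB.instance Definition _ e := SubType.copy (span_of e) {v : V | v \in lin_span e}.
HB.instance Definition _ e := [SubChoice_isSubLmodule of span_of e by <:].

Definition in_span (e : I -> V) (i : I) : span_of e := Sub (e i) (mem_lin_span e i).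
End Bases.

Definition stable (F : fieldType) (L : lieAlgType F) (V : lmodType F)
    (T : representation L V) (U : {pred V}) : Prop :=
  forall l v, v \in U -> T l v \in U.

Section Subrepresentation.
Context (F : fieldType) (L : lieAlgType F) (V : lmodType F) (I : choiceType).
Context (T : representation L V) (e : I -> V) (hs : stable T (lin_span e)).

Definition subrep_fun (l : L) (v : span_of e) : span_of e :=
  Sub (T l (val v)) (hs l (valP v)).

Lemma subrep_linearl v : linear (fun l => subrep_fun l v).
Proof. by move=> a x y; apply: val_inj; rewrite /= rep_linearl. Qed.

Lemma subrep_linearr l : linear (subrep_fun l).
Proof. by move=> a x y; apply: val_inj; rewrite /= rep_linearr. Qed.

Lemma subrep_lie x y v :
  subrep_fun (lie x y) v =
  subrep_fun x (subrep_fun y v) - subrep_fun y (subrep_fun x v).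
Proof. by apply: val_inj; rewrite /= rep_lie. Qed.

Definition subrep : representation L (span_of e) :=
  Representation subrep_linearl subrep_linearr subrep_lie.
End Subrepresentation.

(* edgeE carries two conventions: the weights of edges are non-zero, and
   weight x y = 0 when there is no edge (x, y). *)
Record rwdigraph (M : zmodType) (X : Type) := RWDigraph {
  edge : rel X;
  weight : X -> X -> M;
  edgeE : forall x y, edge x y = (weight x y != 0)
}.

Section Diagram.
Context (F : fieldType) (L : lieAlgType F) (V : lmodType F) (I : choiceType).
Context (T : representation L V) (e : I -> V) (he : is_basis e).

(* w(i, j)(l), the coefficient of e j in T l (e i) *)
Definition diagram_coef (i j : I) (l : L) : F := basis_coord he (T l (e i)) j.

Lemma diagram_coef_linear i j : scalar (diagram_coef i j).
Proof.
by move=> a x y; rewrite /diagram_coef rep_linearl coord_linear.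
Qed.

HB.instance Definition _ i j :=
  GRing.isLinear.Build F L F *%R (diagram_coef i j) (diagram_coef_linear i j).

Definition diagram_weight (i j : I) : dual_space L :=
  (diagram_coef i j : {scalar L}).

Definition diagram : rwdigraph (dual_space L) I :=
  @RWDigraph (dual_space L) I (fun i j => diagram_weight i j != 0) diagram_weight
    (fun _ _ => erefl).
End Diagram.

Section ExteriorPower.
Context (d : Order.disp_t) (X : orderType d).

Definition incr (n : nat) : Type := {t : n.-tuple X | sorted <%O t}.

HB.instance Definition _ n := Choice.on (incr n).
HB.instance Definition _ n := SubType.copy (incr n) {t : n.-tuple X | sorted <%O t}.

Definition entry n (A : incr n) (i : 'I_n) : X := tnth (val A) i.

Lemma erase_sorted n (A : incr n) (i : 'I_n) :
  sorted <%O [tuple entry A (lift i k) | k < n.-1].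
Proof.
apply/(sortedP (entry A i)) => k; rewrite size_tuple => kn.
have k'n : (k < n.-1)%N by apply: ltn_trans kn.
rewrite -(tnth_nth _ _ (Ordinal k'n)) -(tnth_nth _ _ (Ordinal kn)) !tnth_mktuple.
rewrite /entry !(tnth_nth (entry A i)).
apply: (sorted_ltn_nth lt_trans _ (valP A)); rewrite ?inE ?size_tuple ?ltn_ord//.
by rewrite /= /bump; case: (leqP i k) => [/leqW->//|_]; rewrite ltn_addl.
Qed.

(* the entries other than the i-th one; 'I_n being empty for n = 0, the index
   n.-1 is the actual predecessor of n *)
Definition Pr n (i : 'I_n) (A : incr n) : incr n.-1 :=
  Sub [tuple entry A (lift i k) | k < n.-1] (erase_sorted A i).

Context (M : zmodType) (G : rwdigraph M X) (n : nat).
Implicit Types A B : incr n.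

(* in ext_link and ext_weight, p = (i, j) *)
Definition ext_link A B (p : 'I_n * 'I_n) : bool :=
  (Pr p.1 A == Pr p.2 B) && edge G (entry A p.1) (entry B p.2).

Definition ext_edge A B : bool :=
  if A == B then \sum_(i < n) weight G (entry A i) (entry A i) != 0
  else [exists i, exists j, ext_link A B (i, j)].

(* for A != B there is at most one linked pair p, by ext_link_inj below, so that
   the choice of p is immaterial; the sign is a power of -1 : int *)
Definition ext_weight A B : M :=
  if A == B then \sum_(i < n) weight G (entry A i) (entry A i)
  else if [pick p | ext_link A B p] is Some p
  then weight G (entry A p.1) (entry B p.2) *~ ((-1) ^ (p.2%:Z - p.1%:Z))
  else 0.

Lemma ext_link_inj A B p q :
  A != B -> ext_link A B p -> ext_link A B q -> p = q.
Proof.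
have Pr_sub (C D : incr n) (i j : 'I_n) : Pr i C = Pr j D ->
    forall k, k != i -> entry C k \in val (val D).
  move=> CD k ki; have [l lk|/eqP] := unliftP i k; last by rewrite (negbTE ki).
  have -> : entry C k = entry D (lift j l).
    rewrite lk; have /(congr1 (fun t => tnth (val t) l)) := CD.
    by rewrite /= !tnth_mktuple.
  exact: mem_tnth.
have new (C D : incr n) (i j : 'I_n) : C != D -> Pr i C = Pr j D ->
    entry C i \notin val (val D).
  move=> CD PCD; apply/negP => CiD; case/negP: CD; apply/eqP.
  have subCD : {subset val (val C) <= val (val D)}.
    move=> _ /tnthP[k ->]; have [->//|ki] := eqVneq k i.
    exact: Pr_sub PCD k ki.
  have uC : uniq (val (val C)) by apply: lt_sorted_uniq (valP C).
  have [|_ eqCD] := uniq_min_size uC subCD; first by rewrite !size_tuple.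
  exact/val_inj/val_inj/(lt_sorted_eq (valP C) (valP D) eqCD).
have uniq_idx (C D : incr n) (i i' j j' : 'I_n) : C != D ->
    Pr i C = Pr j D -> Pr i' C = Pr j' D -> i = i'.
  move=> CD P P'; apply/eqP/negPn/negP => ii'.
  by have /negP[] := new _ _ _ _ CD P; exact: Pr_sub P' _ ii'.
case: p q => [i j] [i' j'] AB /andP[/eqP P _] /andP[/eqP P' _].
rewrite (uniq_idx A B i i' j j')// (uniq_idx B A j j' i i')//.
by rewrite eq_sym.
Qed.

Lemma ext_weightE A B i j : A != B -> ext_link A B (i, j) ->
  ext_weight A B =
  weight G (entry A i) (entry B j) *~ ((-1) ^ (j%:Z - i%:Z)).
Proof.
move=> AB lij; rewrite /ext_weight (negbTE AB).
by case: pickP => [p /(ext_link_inj AB lij) <-//|/(_ (i, j))]; rewrite lij.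
Qed.

Lemma ext_edgeE A B : ext_edge A B = (ext_weight A B != 0).
Proof.
rewrite /ext_edge /ext_weight; case: ifP => // _.
case: pickP => [[i j] lij|nl]; last first.
  by rewrite eqxx; apply/existsP => -[i /existsP[j]]; rewrite nl.
have -> : [exists i, exists j, ext_link A B (i, j)].
  by apply/existsP; exists i; apply/existsP; exists j.
have /andP[_] := lij; rewrite edgeE => wij; apply/esym.
apply: contraNneq wij => /(congr1 (fun x => x *~ ((-1) ^ (j%:Z - i%:Z)))).
rewrite mul0rz -mulrzA -exprzMl// mulrNN mulr1 exp1rz mulr1z => ->.
by [].
Qed.

Definition ext_power : rwdigraph M (incr n) := RWDigraph ext_edgeE.
End ExteriorPower.

Section TensorPower.
Context (F : fieldType) (V : lmodType F) (n : nat).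

Definition multilinear (U : lmodType F) (g : ('I_n -> V) -> U) : Prop :=
  forall (k : 'I_n) (v : 'I_n -> V), linear (fun x => g [eta v with k |-> x]).

(* universal property: W is V^{⊗n}, and tens v is the tensor v_0 ⊗ ... ⊗ v_(n-1) *)
Definition is_tensor_power (W : lmodType F) (tens : ('I_n -> V) -> W) : Prop :=
  multilinear tens /\
  forall (U : lmodType F) (g : ('I_n -> V) -> U), multilinear g ->
    exists! h : {linear W -> U}, forall v, h (tens v) = g v.

Context (L : lieAlgType F) (T : representation L V).
Context (W : lmodType F) (tens : ('I_n -> V) -> W) (hW : is_tensor_power tens).

(* sum over k of v_0 ⊗ ... ⊗ T(l)v_k ⊗ ... ⊗ v_(n-1), which defines T^{⊗n}(l) *)
Definition leibniz (l : L) (v : 'I_n -> V) : W :=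
  \sum_(k < n) tens [eta v with k |-> T l (v k)].

Lemma leibniz_multilinear l : multilinear (leibniz l).
Proof.
move=> k v a x y; rewrite /leibniz scaler_sumr -big_split/=.
apply: eq_bigr => m _; case: (eqVneq m k) => [->|mk].
  have E z : [eta [eta v with k |-> z] with k |-> T l z] =
             [eta v with k |-> T l z] :> ('I_n -> V).
    by apply/funext => i /=; case: eqP.
  by rewrite !E rep_linearr; exact: hW.1.
have E z : [eta [eta v with k |-> z] with m |-> T l (v m)] =
           [eta [eta v with m |-> T l (v m)] with k |-> z] :> ('I_n -> V).
  apply/funext => i /=; case: (eqVneq i m) => // ->.
  by rewrite (negbTE mk).
by rewrite !E; exact: hW.1.
Qed.

Definition tensor_rep_fun (l : L) : {linear W -> W} :=
  projT1 (cid (hW.2 W (leibniz l) (leibniz_multilinear l))).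

Lemma tensor_rep_funE l v : tensor_rep_fun l (tens v) = leibniz l v.
Proof. by rewrite /tensor_rep_fun; case: cid => h [/= ->]. Qed.

Lemma tensor_ext (U : lmodType F) (h1 h2 : W -> U) : linear h1 -> linear h2 ->
  (forall v, h1 (tens v) = h2 (tens v)) -> h1 =1 h2.
Proof.
move=> lin1 lin2 h12 w.
pose H1 : {linear W -> U} := HB.pack h1 (GRing.isLinear.Build F W U _ h1 lin1).
pose H2 : {linear W -> U} := HB.pack h2 (GRing.isLinear.Build F W U _ h2 lin2).
have mH : multilinear (fun v => H1 (tens v)).
  by move=> k v a x y; rewrite hW.1 linearP.
have [h [_ hu]] := hW.2 U _ mH.
have E1 : h = H1 by apply: hu.
have E2 : h = H2 by apply: hu => v; rewrite /= -h12.
by rewrite -[h1 w]/(H1 w) -E1 E2.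
Qed.

Lemma tensor_rep_linearl w : linear (fun l => tensor_rep_fun l w).
Proof.
move=> a x y; move: w; apply: tensor_ext.
- exact: linearP.
- move=> b u v; rewrite !linearP/= !scalerA [b * a]mulrC.
  by rewrite addrACA.
- move=> v; rewrite !tensor_rep_funE /leibniz scaler_sumr -big_split/=.
  by apply: eq_bigr => k _; rewrite rep_linearl; exact: hW.1.
Qed.

Lemma tensor_rep_linearr l : linear (tensor_rep_fun l).
Proof. exact: linearP. Qed.

Lemma tensor_rep_lie x y w :
  tensor_rep_fun (lie x y) w =
  tensor_rep_fun x (tensor_rep_fun y w) - tensor_rep_fun y (tensor_rep_fun x w).
Proof.
move: w; apply: tensor_ext; first exact: linearP.
  by move=> a u v; rewrite !linearP/= scalerBr scalerN addrACA.
pose cross p q v : W := \sum_(k < n) \sum_(m < n | m != k)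
  tens [eta [eta v with k |-> T q (v k)] with m |-> T p (v m)].
have two p q v : tensor_rep_fun p (tensor_rep_fun q (tens v)) =
    \sum_(k < n) tens [eta v with k |-> T p (T q (v k))] + cross p q v.
  rewrite tensor_rep_funE /leibniz linear_sum -big_split/=.
  apply: eq_bigr => k _; rewrite tensor_rep_funE /leibniz (bigD1 k)//= eqxx.
  congr (_ + _).
    by congr tens; apply/funext => i /=; case: eqP.
  by apply: eq_bigr => m /negbTE ->.
have crossC p q v : cross p q v = cross q p v.
  rewrite /cross (exchange_big_dep xpredT)//=; apply: eq_bigr => k _.
  apply: eq_big => [m|m mk]; first by rewrite eq_sym.
  congr tens; apply/funext => i /=.
  by case: (eqVneq i k) => // ->; rewrite (negbTE mk).
move=> v; rewrite !two (crossC y) opprD addrACA subrr addr0 tensor_rep_funE.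
rewrite /leibniz -sumrB; apply: eq_bigr => k _; rewrite rep_lie.
by rewrite -scaleN1r addrC hW.1 scaleN1r addrC.
Qed.

Definition tensor_rep : representation L W :=
  Representation tensor_rep_linearl tensor_rep_linearr tensor_rep_lie.
End TensorPower.

Definition inversions n (s : 'S_n) : nat :=
  #|[set p : 'I_n * 'I_n | (p.1 < p.2)%N && (s p.2 < s p.1)%N]|.

(* the s-th term is e_{s(i_1)} ⊗ ... ⊗ e_{s(i_n)} with s(i_k) = i_{s(k)} *)
Definition wedge (F : fieldType) (V W : lmodType F) (d : Order.disp_t)
    (I : orderType d) (e : I -> V) (n : nat) (tens : ('I_n -> V) -> W)
    (A : incr I n) : W :=
  \sum_(s : 'S_n) (-1) ^+ inversions s *: tens (fun k => e (entry A (s k))).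

(* Main.v *)
(* Antisymmetrizing the Leibniz rule shows that T(l) sends e_A to the sum over k
   of the wedge products obtained from e_A by replacing the k-th factor x with
   T(l)x.  The functional on the tensor power taking a product of vectors v_k to
   the product of their coordinates at the entries of B sends an alternating
   tensor to a determinant.  On the e_A these functionals form a dual family, so
   the e_A are independent; and the e_B-coefficient of T(l)e_A is a sum of
   determinants with one row of weights and 0/1 rows elsewhere, whose Laplace
   expansion along that row keeps exactly the pairs (k, j) with
   Pr_k A = Pr_j B, with signs (-1)^(k+j). *)
Require Import Defs.
From HB Require Import structures.
From mathcomp Require Import all_boot all_order all_algebra.
From mathcomp Require Import all_fingroup all_classical.

Set Implicit Arguments.
Unset Strict Implicit.
Unset Printing Implicit Defensive.

Import Order.TTheory GRing.Theory Num.Theory.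
Local Open Scope ring_scope.

(* The Vandermonde determinant of 0, ..., n-1 is positive, and the sign of the
   one with permuted nodes counts the inversions. *)
Lemma odd_inversions n (s : 'S_n) : odd (inversions s) = s.
Proof.
pose a : 'rV[int]_n := \row_i i%:Z.
have sgV (t : 'S_n) :
    Num.sg (\det (Vandermonde n (col_perm t a))) = (-1) ^+ inversions t.
  rewrite det_Vandermonde.
  rewrite (pair_big_dep xpredT (fun i j : 'I_n => (i < j)%N))/=.
  rewrite (big_morph _ (@sgrM _) (@sgr1 _)).
  rewrite (bigID (fun p : 'I_n * 'I_n => (t p.2 < t p.1)%N))/=.
  rewrite [X in _ * X]big1 ?mulr1 => [|[i j] /= /andP[ij]]; last first.
    rewrite -leqNgt leq_eqVlt => /orP[|tij].
      rewrite (inj_eq val_inj) (inj_eq perm_inj) => /eqP ij'.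
      by rewrite ij' ltnn in ij.
    by rewrite !mxE gtr0_sg// subr_gt0 ltz_nat.
  rewrite /inversions -prodr_const; apply: eq_big => [p|[i j] /= /andP[_ tij]].
    by rewrite inE.
  by rewrite !mxE ltr0_sg// subr_lt0 ltz_nat.
(* Nodes index columns, so permuting them multiplies the determinant by the sign of [s]. *)
have Vperm : Vandermonde n (col_perm s a) = col_perm s (Vandermonde n a).
  by apply/matrixP => i j; rewrite !mxE.
have inv1 : inversions (1%g : 'S_n) = 0%N.
  rewrite /inversions; apply: eq_card0 => p; rewrite !inE !perm1.
  by apply/negP => /andP[/ltn_trans lt /lt]; rewrite ltnn.
have a1 : a = col_perm 1 a by apply/matrixP => i j; rewrite !mxE perm1.
have := sgV s.
rewrite Vperm col_permE det_mulmx sgrM a1 sgV inv1 mul1r det_perm odd_permV.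
rewrite sgrX sgrN1 -[RHS]signr_odd.
by case: (odd _) (odd_perm _) => [] [].
Qed.

(** * Increasing sequences and their incidence determinants *)

Section IncreasingSequences.
Context (d : Order.disp_t) (X : orderType d) (n : nat).
Implicit Types A B : incr X n.

Lemma entry_inj A : injective (entry A).
Proof.
apply/tuple_uniqP; exact: lt_sorted_uniq (valP A).
Qed.

Lemma incr_subset A B : {subset val (val A) <= val (val B)} -> A = B.
Proof.
move=> AB; have [|_ eqAB] := uniq_min_size (lt_sorted_uniq (valP A)) AB.
  by rewrite !size_tuple.
exact/val_inj/val_inj/(lt_sorted_eq (valP A) (valP B) eqAB).
Qed.

(** Both sequences have [n] entries, so if they differ, some entry of [A] is missing from [B] and
    its row is zero. *)
Lemma det_entry_delta (R : comNzRingType) A B :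
  \det (\matrix_(i, j) (entry A i == entry B j)%:R : 'M[R]_n) = (A == B)%:R.
Proof.
case: eqVneq => [->|AB].
  rewrite -[RHS](det1 _ n); congr (\det _); apply/matrixP => i j.
  by rewrite !mxE (inj_eq (@entry_inj B)).
have [i iB] : exists i, entry A i \notin val (val B).
  apply/existsP; apply: contra_neqT AB => /existsPn AB.
  by apply: incr_subset => _ /tnthP[i ->]; apply/negPn; exact: AB.
rewrite (expand_det_row _ i) big1// => j _; rewrite mxE.
case: eqP => [E|_]; last by rewrite mul0r.
by case/negP: iB; rewrite E mem_tnth.
Qed.

Lemma sort_injective (f : 'I_n -> X) : injective f ->
  exists A (s : 'S_n), f = entry A \o s.
Proof.
move=> finj; pose t := [tuple f i | i < n].
have ut : uniq t by apply/tuple_uniqP => i j; rewrite !tnth_mktuple => /finj.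
pose u : n.-tuple X := [tuple of sort <=%O t].
have su : sorted <%O u.
  by rewrite lt_sorted_uniq_le sort_uniq ut sort_le_sorted.
have /tuple_permP[s ts] : perm_eq t u by rewrite perm_sym perm_sort.
exists (Sub u su), s; apply/funext => i /=.
rewrite -[LHS](tnth_mktuple f) -/t.
have -> : t = [tuple tnth u (s i) | i < n] by exact: val_inj.
by rewrite tnth_mktuple.
Qed.
End IncreasingSequences.

(** * Finite expansions, spans and dual families *)

Lemma fsbig_scale_support (F : fieldType) (U : lmodType F) (I : choiceType)
    (c : I -> F) (g : I -> U) :
  let S := [set i | c i != 0]%classic in finite_set S ->
  \sum_(i \in [set: I]%classic) c i *: g i =
  \sum_(i <- finmap.enum_fset (fset_set S)) c i *: g i.
Proof.
move=> S cf; rewrite -(@fsbig_widen _ _ _ _ S)//; first exact: fsbig_finite.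
by move=> i [_ /= /negP/negPn/eqP->]; rewrite scale0r.
Qed.

Lemma expansion_span (F : fieldType) (V : lmodType F) (I : choiceType)
    (e : I -> V) (v : span_of e) c :
  expansion (in_span e) v c <-> expansion e (val v) c.
Proof.
by split=> -[cf vE]; split => //; [rewrite vE | apply: val_inj; rewrite vE];
  rewrite !fsbig_scale_support// raddf_sum; apply: eq_bigr => i _.
Qed.

Section DualFamily.
Context (F : fieldType) (V : lmodType F) (I : choiceType) (e : I -> V).
Context (phi : I -> {scalar V}).
Context (phi_e : forall i j, phi j (e i) = (i == j)%:R).

Lemma expansion_dual v c j : expansion e v c -> phi j v = c j.
Proof.
move=> [cf ->]; rewrite fsbig_scale_support// linear_sum/=.
have E i : phi j (c i *: e i) = if i == j then c j else 0.
  by rewrite scalarZ phi_e; case: eqP => [->|_]; rewrite ?mulr1 ?mulr0.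
under eq_bigr do rewrite E.
rewrite -big_mkcond/=; have [cj|cj] := eqVneq (c j) 0; first by rewrite big1.
rewrite -big_filter filter_pred1_uniq ?big_seq1 ?finmap.fset_uniq//.
by rewrite in_fset_set// mem_setE.
Qed.

(** Expansions exist by definition of the span; the functionals [phi] read off the coefficients and
    so give uniqueness. *)
Lemma dual_is_basis : is_basis (in_span e).
Proof.
move=> v; have /asboolP[c cv] := valP v; exists c; split.
  exact/expansion_span.
move=> b /expansion_span bv; apply/funext => j.
by rewrite -(expansion_dual j cv) (expansion_dual j bv).
Qed.

Lemma dual_coord (he : is_basis (in_span e)) v j :
  basis_coord he v j = phi j (val v).
Proof.
exact/esym/expansion_dual/expansion_span/coord_expansion.
Qed.
End DualFamily.

Lemma basis_coord_delta (F : fieldType) (V : lmodType F) (I : choiceType)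
  (e : I -> V) (he : is_basis e) i j : basis_coord he (e i) j = (i == j)%:R.
Proof. by rewrite (coord_unique he (expansion_delta e i)) eq_sym. Qed.

Lemma linear_mem_submod (F : fieldType) (V U : lmodType F) (I : choiceType)
    (e : I -> V) (he : is_basis e) (S : submodClosed U) (h : V -> U) :
  linear h -> (forall i, h (e i) \in S) -> forall v, h v \in S.
Proof.
move=> lh he_S v.
pose H : {linear V -> U} := HB.pack h (GRing.isLinear.Build F V U _ h lh).
rewrite -[h v]/(H v).
have [cf ->] := coord_expansion he v.
rewrite fsbig_scale_support// linear_sum; apply: rpred_sum => i _.
by rewrite linearZ; apply: rpredZ; apply: he_S.
Qed.

(** The field [edgeE] makes the weights determine the edges. *)
Lemma rwdigraph_eq (M : zmodType) (X : Type) (G H : rwdigraph M X) :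
  weight G =2 weight H -> G = H.
Proof.
case: G H => [g v gE] [h w hE] /= vw.
have E : v = w by apply/funext => x; apply/funext => y; exact: vw.
subst w; have Eg : g = h.
  by apply/funext => x; apply/funext => y; rewrite gE hE.
subst h; congr RWDigraph.
exact: Prop_irrelevance.
Qed.

(** * Alternating tensors of arbitrary vectors *)

Section AlternatingTensor.
Context (F : fieldType) (V W : lmodType F) (n : nat).
Context (tens : ('I_n -> V) -> W).
Implicit Types v : 'I_n -> V.

(** Arbitrary vectors are allowed, because replacing a factor [x] by [T l x] leaves the basis. *)
Definition alt_tensor v : W :=
  \sum_(s : 'S_n) (-1) ^+ s *: tens (v \o s).

Lemma wedgeE (d : Order.disp_t) (I : orderType d) (e : I -> V) (A : incr I n) :
  wedge e tens A = alt_tensor (e \o entry A).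
Proof. by apply: eq_bigr => s _; rewrite -signr_odd odd_inversions. Qed.

Lemma alt_tensor_perm v (t : 'S_n) :
  alt_tensor (v \o t) = (-1) ^+ t *: alt_tensor v.
Proof.
rewrite /alt_tensor scaler_sumr (reindex_inj (mulIg t^-1%g))/=.
apply: eq_bigr => s _; rewrite scalerA odd_permM odd_permV signr_addb mulrC.
congr (_ *: tens _); apply/funext => i /=.
by rewrite permM permKV.
Qed.

(** The terms of [s] and [s * t] cancel in pairs. Antisymmetry alone would not suffice in
    characteristic 2. *)
Lemma alt_tensor_alternate v i j : i != j -> v i = v j -> alt_tensor v = 0.
Proof.
move=> ij vij; pose t := tperm i j.
have oddMt (s : 'S_n) : (s * t)%g = ~~ s :> bool.
  by rewrite odd_permM odd_tperm ij addbT.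
rewrite /alt_tensor (bigID (@odd_perm _))/=.
apply: canLR (subrK _) _; rewrite add0r -sumrN.
rewrite (reindex_inj (mulIg t)); apply: eq_big => //= s.
rewrite oddMt => /negPf->; rewrite scaleN1r scale1r; congr (- tens _).
by apply/funext => k /=; rewrite permM; case: tpermP => // ->; rewrite vij.
Qed.

Lemma alt_tensor_multilinear : multilinear tens -> multilinear alt_tensor.
Proof.
move=> mt k v a x y; rewrite /alt_tensor scaler_sumr -big_split/=.
apply: eq_bigr => s _; rewrite scalerA mulrC -scalerA -scalerDr; congr (_ *: _).
have E z : [eta v with k |-> z] \o s =
           [eta v \o s with (s^-1)%g k |-> z] :> ('I_n -> V).
  by apply/funext => i /=; rewrite -(canF_eq (permK s)).
by rewrite !E mt.
Qed.

Lemma alt_tensor_rep (L : lieAlgType F) (T : representation L V)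
    (hW : is_tensor_power tens) l v :
  tensor_rep T hW l (alt_tensor v) =
  \sum_(k < n) alt_tensor [eta v with k |-> T l (v k)].
Proof.
rewrite /= [LHS]linear_sum exchange_big/=; apply: eq_bigr => s _.
rewrite linearZ/= tensor_rep_funE /leibniz -scaler_sumr; congr (_ *: _).
(* Slot [k] of [v \o s] holds the vector in slot [s k] of [v]. *)
rewrite [RHS](reindex_perm s)/=; apply: eq_bigr => k _.
by congr tens; apply/funext => i /=; rewrite (inj_eq perm_inj).
Qed.

(** Distinct indices can be sorted at the cost of a sign; a repeated index gives zero. *)
Lemma alt_tensor_span (d : Order.disp_t) (I : orderType d) (e : I -> V)
  (f : 'I_n -> I) : alt_tensor (e \o f) \in lin_span (wedge e tens).
Proof.
have [/injectiveP/sort_injective[A [s ->]]|/injectivePn[i [j ij fij]]] :=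
  boolP (injectiveb f).
  by rewrite (alt_tensor_perm (e \o entry A)) rpredZ// -wedgeE mem_lin_span.
by rewrite (alt_tensor_alternate ij) ?rpred0//= fij.
Qed.
End AlternatingTensor.

(** * Coordinate functionals and the action on wedge products *)

Section WedgeCoordinates.
Context (F : fieldType) (V : lmodType F) (d : Order.disp_t) (I : orderType d).
Context (e : I -> V) (he : is_basis e) (n : nat) (W : lmodType F).
Context (tens : ('I_n -> V) -> W) (hW : is_tensor_power tens).
Implicit Types A B : incr I n.

Let prod_coord (B : incr I n) (v : 'I_n -> V) : F^o :=
  \prod_(k < n) basis_coord he (v k) (entry B k).

Let prod_coord_multilinear B : multilinear (prod_coord B).
Proof.
move=> k v a x y.
have E z : prod_coord B [eta v with k |-> z] = basis_coord he z (entry B k) *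
    \prod_(i < n | i != k) basis_coord he (v i) (entry B i).
  rewrite /prod_coord (bigD1 k)//= eqxx; congr (_ * _).
  by apply: eq_bigr => i /negbTE ->.
by rewrite !E coord_linear mulrDl -mulrA.
Qed.

Definition wedge_coord B : {scalar W} :=
  projT1 (cid (hW.2 F^o (prod_coord B) (@prod_coord_multilinear B))).

Lemma wedge_coord_tens B v :
  wedge_coord B (tens v) = \prod_(k < n) basis_coord he (v k) (entry B k).
Proof. by rewrite /wedge_coord; case: cid => h [/= ->]. Qed.

Lemma wedge_coord_alt B v : wedge_coord B (alt_tensor tens v) =
  \det (\matrix_(i, j) basis_coord he (v i) (entry B j)).
Proof.
(* The alternating sum permutes the vectors, which are the rows, so the Leibniz formula is applied
   to the transpose. *)
rewrite -det_tr linear_sum; apply: eq_bigr => s _.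
rewrite scalarZ wedge_coord_tens; congr (_ * _).
by apply: eq_bigr => k _; rewrite !mxE.
Qed.

Lemma wedge_coord_delta A B :
  wedge_coord B (wedge e tens A) = (A == B)%:R.
Proof.
rewrite wedgeE wedge_coord_alt -det_entry_delta; congr (\det _).
by apply/matrixP => i j; rewrite !mxE basis_coord_delta.
Qed.

(* Laplace expansion along the k-th row; the complementary minors are the
   matrices of det_entry_delta for the erased sequences. *)
Lemma wedge_coord_replace A B (k : 'I_n) x :
  wedge_coord B (alt_tensor tens [eta e \o entry A with k |-> x]) =
  \sum_(j < n | Pr k A == Pr j B) (-1) ^+ (k + j) * basis_coord he x (entry B j).
Proof.
rewrite wedge_coord_alt (expand_det_row _ k) [RHS]big_mkcond/=.
apply: eq_bigr => j _; rewrite mxE /= eqxx /cofactor.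
have -> : row' k (col' j (\matrix_(i, j0) basis_coord he
      (if i == k then x else e (entry A i)) (entry B j0))) =
    \matrix_(i, j0) (entry (Pr k A) i == entry (Pr j B) j0)%:R.
  apply/matrixP => i m; rewrite !mxE eq_sym (negbTE (neq_lift _ _)).
  by rewrite basis_coord_delta /entry /= !tnth_mktuple.
rewrite det_entry_delta mulrA mulrC.
by case: eqP => _; rewrite ?mul0r // mul1r mulrC.
Qed.

Lemma wedge_basis : is_basis (in_span (wedge e tens)).
Proof. exact: dual_is_basis wedge_coord_delta. Qed.

Context (L : lieAlgType F) (T : representation L V).

Lemma wedge_stable : stable (tensor_rep T hW) (lin_span (wedge e tens)).
Proof.
move=> l; move=> _ /asboolP[c [cf ->]].
rewrite fsbig_scale_support// [tensor_rep _ _ _ _]linear_sum.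
apply: rpred_sum => A _; rewrite linearZ rpredZ//.
have -> : tensor_rep_fun T hW l (wedge e tens A) =
  \sum_(k < n) alt_tensor tens [eta e \o entry A with k |-> T l (e (entry A k))].
  by rewrite wedgeE; exact: (alt_tensor_rep T hW).
apply: rpred_sum => k _.
pose h x := alt_tensor tens [eta e \o entry A with k |-> x].
(* By linearity in slot [k], the vector put there may be taken to be a basis vector. *)
apply: (linear_mem_submod he (h := h)) => [|b].
  exact: alt_tensor_multilinear hW.1 _ _.
rewrite /h.
have -> : [eta e \o entry A with k |-> e b] =
    e \o [eta entry A with k |-> b] :> ('I_n -> V).
  by apply/funext => i /=; case: eqP.
exact: alt_tensor_span.
Qed.

Lemma wedge_coord_rep A B l :
  wedge_coord B (tensor_rep T hW l (wedge e tens A)) =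
  \sum_(k < n) \sum_(j < n | Pr k A == Pr j B)
    (-1) ^+ (k + j) * diagram_coef T he (entry A k) (entry B j) l.
Proof.
rewrite wedgeE alt_tensor_rep linear_sum/=; apply: eq_bigr => k _.
exact: wedge_coord_replace.
Qed.
End WedgeCoordinates.

(** * Weights of the exterior power as signed sums *)

Lemma Pr_inj (d : Order.disp_t) (I : orderType d) n (A : incr I n) (i j : 'I_n) :
  Pr i A = Pr j A -> i = j.
Proof.
move=> P; apply/eqP/negPn/negP => ij.
have [k jk|/eqP] := unliftP i j; last by rewrite eq_sym (negbTE ij).
have := congr1 (fun t => entry t k) P.
rewrite /entry /= !tnth_mktuple -jk => /entry_inj/eqP.
by rewrite (negbTE (neq_lift _ _)).
Qed.

Lemma dual_fun_zmod (F : comPzRingType) (L : lmodType F) (l : L) :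
  zmod_morphism (fun w : dual_space L => dual_fun w l).
Proof. by []. Qed.

Lemma sign_subz (k j : nat) : (-1) ^ (j%:Z - k%:Z) = (-1) ^+ (k + j) :> int.
Proof.
by rewrite exprzDr ?unitrN1// addnC exprD -exprz_inv invrN1.
Qed.

Section ExtWeight.
Context (F : fieldType) (L : lmodType F) (d : Order.disp_t) (X : orderType d).
Context (G : rwdigraph (dual_space L) X) (n : nat).
Implicit Types A B : incr X n.

(** One formula covers loops and other edges. For [A = B], [Pr_inj] leaves only [j = k], with sign
    +1. For [A != B], [ext_link_inj] leaves at most one linked pair. *)
Lemma ext_weight_dual A B l :
  dual_fun (ext_weight G A B) l =
  \sum_(k < n) \sum_(j < n | Pr k A == Pr j B)
    (-1) ^+ (k + j) * dual_fun (weight G (entry A k) (entry B j)) l.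
Proof.
pose ev : {additive dual_space L -> F} :=
  HB.pack (fun w : dual_space L => dual_fun w l)
    (GRing.isZmodMorphism.Build _ _ _ (@dual_fun_zmod _ _ l)).
have evM w z : dual_fun (w *~ z) l = dual_fun w l *~ z.
  exact: (raddfMz ev).
rewrite /ext_weight -[dual_fun _ _]/(ev _); case: eqVneq => [<-|AB].
  rewrite raddf_sum; apply: eq_bigr => k _.
  rewrite (big_pred1 k) => [|j].
    by rewrite -signr_odd oddD addbb mul1r.
  by apply/eqP/eqP => [/Pr_inj|->].
rewrite pair_big_dep/=; case: pickP => [[k j] lkj|nl].
  have /andP[/= Pkj _] := lkj.
  rewrite (bigD1 (k, j))//= [X in _ = _ + X]big1 ?addr0.
    by rewrite evM -mulrzl sign_subz rmorph_sign.
  move=> p /andP[Pp pkj]; apply/eqP; apply: contraNT pkj => wp; apply/eqP.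
  apply: (ext_link_inj AB _ lkj); rewrite /ext_link Pp edgeE /=.
  (* A pair with equal erasures but no edge has weight zero, so a non-zero term comes from a linked
     pair. *)
  by apply: contraNneq wp => ->; rewrite dual0E mulr0.
rewrite dual0E big1// => p Pp; apply/eqP.
have /negbT := nl p; rewrite /ext_link Pp edgeE /= negbK => /eqP ->.
by rewrite dual0E mulr0.
Qed.
End ExtWeight.

Theorem proposition10 (F : fieldType) (L : lieAlgType F) (V : lmodType F)
    (T : representation L V) (d : Order.disp_t) (I : orderType d) (e : I -> V)
    (he : is_basis e) (n : nat) (W : lmodType F) (tens : ('I_n -> V) -> W)
    (hW : is_tensor_power tens) :
  exists (hb : is_basis (in_span (wedge e tens)))
         (hs : stable (tensor_rep T hW) (lin_span (wedge e tens))),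
    diagram (subrep hs) hb = ext_power (diagram T he) n.
Proof.
exists (wedge_basis he hW), (wedge_stable he hW T).
apply: rwdigraph_eq => A B; apply: dualP => l.
rewrite ext_weight_dual -[LHS]/(basis_coord _ _ _).
by rewrite (dual_coord (wedge_coord_delta he hW)) wedge_coord_rep.
Qed.
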